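(* Let $\langle s = t\rangle$ be a unification problem (with $s,t$ simple list expressions without common variables) and let $\delta$ be a unifier of it, i.e. $s\delta =_{\mathrm{AU}} t\delta$. Then there exists a unifier $\sigma$ generated by $\textsf{Unify}$ on input $s = t$ such that $\sigma \leq \delta$, i.e. there is a substitution $\lambda$ with $x\delta =_{\mathrm{AU}} (x\sigma)\lambda$ for every variable $x$ occurring in $s$ or $t$.
   Context: Expressions: built from integer constants, string constants, the constant $\mathtt{empty}$, variables of the disjoint types $\mathtt{int},\mathtt{string},\mathtt{atom},\mathtt{list}$, and list concatenation $\mathtt{:}$. Types: $\mathtt{int},\mathtt{string} < \mathtt{atom} < \mathtt{list}$, with $\mathtt{int}$ and $\mathtt{string}$ incomparable (written $\|$). After normalisation, each expression has a smallest type: integer constants/variables have type $\mathtt{int}$, string constants/variables type $\mathtt{string}$, atom variables type $\mathtt{atom}$, and $\mathtt{empty}$, list variables and concatenations of at least two items type $\mathtt{list}$. A simple expression uses no operator other than $\mathtt{:}$ and contains at most one occurrence of a list variable. Normalisation: apply $L\mathtt{:}\mathtt{empty} \to L$, $\mathtt{empty}\mathtt{:}L \to L$ exhaustively. A substitution maps variables to expressions of their type; $t\theta$ is simultaneous replacement; $\sigma\circ\theta$ is defined by $x(\sigma\circ\theta) = (x\sigma)\theta$ if $x \in \mathrm{Dom}(\sigma)=\{x\mid x\sigma\neq x\}$ and $x\theta$ otherwise. $=_{\mathrm{AU}}$ is the congruence generated by $x\mathtt{:}(y\mathtt{:}z) = (x\mathtt{:}y)\mathtt{:}z$, $\mathtt{empty}\mathtt{:}x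 = x$, $x\mathtt{:}\mathtt{empty} = x$. A unification problem is either $\langle s = t, \sigma\rangle$ with $s,t$ simple list expressions without common variables ($\langle s=t\rangle$ abbreviates $\langle s=t,\varnothing\rangle$), or a solved problem $\langle \varnothing, \sigma\rangle$, or $\mathtt{fail}$. Transformation relation $\Rightarrow$: in the rules below, $L,M$ range over simple expressions (possibly $\mathtt{empty}$), $\mathtt{x},\mathtt{y}$ over variables of any type, $\mathtt{a},\mathtt{b}$ over integer/string constants or variables of type $\mathtt{int},\mathtt{string},\mathtt{atom}$, and $\mathtt{s}$ over integer/string constants or variables of any type. A rule applies to $P$ if its premise, after instantiation and normalisation, is identical to $P$ and its side conditions hold; the result is the normalised conclusion. Fresh variables are new list variables. Remove: $\langle L=L,\sigma\rangle \Rightarrow \langle\varnothing,\sigma\rangle$. Decomp1: $\langle \mathtt{x}\mathtt{:}L = \mathtt{s}\mathtt{:}M,\sigma\rangle \Rightarrow \langle L=M, \sigma\circ\{\mathtt{x}\mapsto\mathtt{s}\}\rangle$ if $L\neq\mathtt{empty}$, $\mathrm{type}(\mathtt{x})=\mathtt{list}$. Decomp1': $\langle \mathtt{x}\mathtt{:}L = \mathtt{a}\mathtt{:}M,\sigma\rangle \Rightarrow \langle (L=M)\{\mathtt{x}\mapsto\mathtt{a}\}, \sigma\circ\{\mathtt{x}\mapsto\mathtt{a}\}\rangle$ if $L\neq\mathtt{empty}$, $\mathrm{type}(\mathtt{a})\le\mathrm{type}(\mathtt{x})\le\mathtt{atom}$. Decomp2: $\langle \mathtt{x}\mathtt{:}L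 = \mathtt{y}\mathtt{:}M,\sigma\rangle \Rightarrow \langle \mathtt{x'}\mathtt{:}L = M, \sigma\circ\{\mathtt{x}\mapsto\mathtt{y}\mathtt{:}\mathtt{x'}\}\rangle$ if $L\neq\mathtt{empty}$, $\mathtt{x},\mathtt{y}$ of type $\mathtt{list}$, $\mathtt{x'}$ fresh. Decomp2': $\langle \mathtt{x}\mathtt{:}L = \mathtt{y}\mathtt{:}M,\sigma\rangle \Rightarrow \langle L = \mathtt{y'}\mathtt{:}M, \sigma\circ\{\mathtt{y}\mapsto\mathtt{x}\mathtt{:}\mathtt{y'}\}\rangle$ if $L\neq\mathtt{empty}$, $\mathtt{x},\mathtt{y}$ of type $\mathtt{list}$, $\mathtt{y'}$ fresh. Decomp3: $\langle \mathtt{s}\mathtt{:}L = \mathtt{s}\mathtt{:}M,\sigma\rangle \Rightarrow \langle L=M,\sigma\rangle$. Decomp4: $\langle \mathtt{x} = \mathtt{a}\mathtt{:}\mathtt{y},\sigma\rangle \Rightarrow \langle \mathtt{empty}=\mathtt{y}, \sigma\circ\{\mathtt{x}\mapsto\mathtt{a}\}\rangle$ if $\mathrm{type}(\mathtt{x})=\mathtt{atom}$, $\mathrm{type}(\mathtt{y})=\mathtt{list}$. Subst1: $\langle \mathtt{x} = L,\sigma\rangle \Rightarrow \langle\varnothing, \sigma\circ\{\mathtt{x}\mapsto L\}\rangle$ if $\mathtt{x}\notin\mathrm{Var}(L)$, $\mathrm{type}(\mathtt{x})\ge\mathrm{type}(L)$. Subst2: $\langle \mathtt{x}\mathtt{:}L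 = M,\sigma\rangle \Rightarrow \langle L=M, \sigma\circ\{\mathtt{x}\mapsto\mathtt{empty}\}\rangle$ if $L\neq\mathtt{empty}$, $\mathrm{type}(\mathtt{x})=\mathtt{list}$. Subst3: $\langle \mathtt{x}\mathtt{:}L = \mathtt{a}\mathtt{:}M,\sigma\rangle \Rightarrow \langle \mathtt{x'}\mathtt{:}L=M, \sigma\circ\{\mathtt{x}\mapsto\mathtt{a}\mathtt{:}\mathtt{x'}\}\rangle$ if $L\neq\mathtt{empty}$, $\mathtt{x'}$ fresh, $\mathrm{type}(\mathtt{x})=\mathtt{list}$. Orient1: $\langle \mathtt{a}\mathtt{:}M = \mathtt{x}\mathtt{:}L,\sigma\rangle \Rightarrow \langle \mathtt{x}\mathtt{:}L = \mathtt{a}\mathtt{:}M,\sigma\rangle$ if $\mathtt{a}$ is not a variable. Orient2: $\langle \mathtt{x}\mathtt{:}L = \mathtt{y},\sigma\rangle \Rightarrow \langle \mathtt{y} = \mathtt{x}\mathtt{:}L,\sigma\rangle$ if $L\neq\mathtt{empty}$, $\mathrm{type}(\mathtt{x})=\mathrm{type}(\mathtt{y})$. Orient3: $\langle \mathtt{y}\mathtt{:}M = \mathtt{x}\mathtt{:}L,\sigma\rangle \Rightarrow \langle \mathtt{x}\mathtt{:}L = \mathtt{y}\mathtt{:}M,\sigma\rangle$ if $\mathrm{type}(\mathtt{y})<\mathrm{type}(\mathtt{x})$. Orient4: $\langle \mathtt{empty} = \mathtt{x}\mathtt{:}L,\sigma\rangle \Rightarrow \langle \mathtt{x}\mathtt{:}L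 = \mathtt{empty},\sigma\rangle$ if $\mathrm{type}(\mathtt{x})=\mathtt{list}$. Failure rules (each yields $\mathtt{fail}$): Occur: $\langle\mathtt{x}=L,\sigma\rangle$ with $\mathtt{x}\in\mathrm{Var}(L)$, $\mathtt{x}\neq L$, $\mathrm{type}(\mathtt{x})=\mathtt{list}$; Clash1: $\langle \mathtt{a}\mathtt{:}L=\mathtt{b}\mathtt{:}M,\sigma\rangle$ with $\mathtt{a}\neq\mathtt{b}$ both variable-free; Clash2: $\langle \mathtt{a}\mathtt{:}L=\mathtt{empty},\sigma\rangle$; Clash3: $\langle \mathtt{empty}=\mathtt{a}\mathtt{:}L,\sigma\rangle$; Clash4: $\langle \mathtt{x}=L,\sigma\rangle$ with $\mathrm{type}(\mathtt{x})\,\|\,\mathrm{type}(L)$. Algorithm $\textsf{Unify}$: normalise the input problem $\langle s=t,\varnothing\rangle$ and place it in a queue; set $U=\emptyset$. While the queue is nonempty, dequeue a problem $N$: if $N=\langle\varnothing,\sigma\rangle$, add $\sigma$ to $U$; otherwise, if no failure rule applies to $N$, enqueue the normalised result of every (non-failure) transformation step $N\Rightarrow P'$. Return $U$. The unifiers generated by $\textsf{Unify}$ are the elements of $U$.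
   Formalization: Unify has one extra rule: Decomp4 also applies when x has type int or string with type(a) ≤ type(x). Without it the claim fails: x = 1:y (x int, y list) is unified by x↦1, y↦empty, but no rule applies and Unify returns the empty set. *)

(* Defs.v *)
(* Stdlib world. *)
From Stdlib Require Import ZArith List.
From Stdlib Require String.
Import ListNotations.

Inductive ty : Set := TInt | TStr | TAtom | TList.

(* Reflexive closure of  int, string < atom < list. *)
Definition tle (a b : ty) : bool :=
  match a, b with
  | _, TList => true
  | TList, _ => false
  | _, TAtom => true
  | TAtom, _ => false
  | TInt, TInt => true
  | TStr, TStr => true
  | _, _ => false
  end.
Definition tlt (a b : ty) : Prop := tle a b = true /\ a <> b.
Definition tincomp (a b : ty) : Prop := tle a b = false /\ tle b a = false.

Record var : Set := Var { vty : ty; vname : nat }.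

Definition var_eq_dec (x y : var) : {x = y} + {x <> y}.
Proof. repeat decide equality. Defined.

Inductive item : Set :=
| IInt (z : Z)
| IStr (w : String.string)
| IVar (x : var).

Inductive expr : Set :=
| Empty
| Item (i : item)
| Cat (e1 e2 : expr).

(* =_AU *)
Inductive au : expr -> expr -> Prop :=
| au_refl e : au e e
| au_sym e f : au e f -> au f e
| au_trans e f g : au e f -> au f g -> au e g
| au_cat e e' f f' : au e e' -> au f f' -> au (Cat e f) (Cat e' f')
| au_assoc e f g : au (Cat e (Cat f g)) (Cat (Cat e f) g)
| au_emptyl e : au (Cat Empty e) e
| au_emptyr e : au (Cat e Empty) e.

Fixpoint occurs (x : var) (e : expr) : Prop :=
  match e with
  | Empty => False
  | Item i => i = IVar x
  | Cat e1 e2 => occurs x e1 \/ occurs x e2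
  end.

Fixpoint nb_list_vars (e : expr) : nat :=
  match e with
  | Item (IVar (Var TList _)) => 1
  | Cat e1 e2 => nb_list_vars e1 + nb_list_vars e2
  | _ => 0
  end.
Definition simple (e : expr) : Prop := nb_list_vars e <= 1.

Definition disjoint_vars (s t : expr) : Prop :=
  forall x, occurs x s -> ~ occurs x t.

(* Concatenation is written without parentheses, so a normalised expression
   i1:...:in (containing no superfluous empty) is represented by the list of
   its items, and empty by nil.  Consequently the pattern x:L, where L may be
   empty, is x :: L. *)
Definition nexpr := list item.
Fixpoint nf (e : expr) : nexpr :=
  match e with
  | Empty => []
  | Item i => [i]
  | Cat e1 e2 => nf e1 ++ nf e2
  end.
Fixpoint to_expr (L : nexpr) : expr :=
  match L with
  | [] => Empty
  | [i] => Item i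
  | i :: L' => Cat (Item i) (to_expr L')
  end.

Definition ity (i : item) : ty :=
  match i with IInt _ => TInt | IStr _ => TStr | IVar x => vty x end.
(* Smallest type of a normalised expression. *)
Definition type_of (L : nexpr) : ty :=
  match L with [i] => ity i | _ => TList end.

(* The items denoted a, b in the rules: everything but list variables. *)
Definition atomic (i : item) : Prop := ity i <> TList.
Definition is_var (i : item) : Prop := exists x, i = IVar x.

Definition subst := var -> expr.
Definition substitution (th : subst) : Prop :=
  forall x, tle (type_of (nf (th x))) (vty x) = true.

Fixpoint app (e : expr) (th : subst) : expr :=
  match e with
  | Empty => Empty
  | Item (IVar x) => th x
  | Item i => Item i
  | Cat e1 e2 => Cat (app e1 th) (app e2 th)
  end.

Definition in_dom (sg : subst) (x : var) : Prop := sg x <> Item (IVar x).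
Definition id_subst : subst := fun x => Item (IVar x).
Definition sub1 (x : var) (e : expr) : subst :=
  fun y => if var_eq_dec x y then e else Item (IVar y).
(* First sg, then th.  Outside the domain of sg, sg x is x itself, so that
   (x sg) th is x th, as required there. *)
Definition comp (sg th : subst) : subst := fun x => app (sg x) th.

Definition unifier (s t : expr) (th : subst) : Prop :=
  substitution th /\ au (app s th) (app t th).

(* sg <= de on the variables of s and t. *)
Definition more_general (s t : expr) (sg de : subst) : Prop :=
  exists la, substitution la /\
    forall x, occurs x s \/ occurs x t -> au (de x) (app (sg x) la).

(* Eqn L M sg is the normalised problem < L = M, sg >,
   Solved sg is < {}, sg >. *)
Inductive problem : Type :=
| Eqn (L M : nexpr) (sg : subst)
| Solved (sg : subst)
| Fail.

Definition nsub (L : nexpr) (x : var) (i : item) : nexpr :=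
  nf (app (to_expr L) (sub1 x (Item i))).

(* step x' P Q : P => Q, where x' is the variable that the rules Decomp2,
   Decomp2' and Subst3 introduce; its freshness is imposed by [fresh_supply]
   below.  Both sides of a problem are simple, hence so are the L and M
   matched here. *)
Inductive step (x' : var) : problem -> problem -> Prop :=
| Remove L sg :
    step x' (Eqn L L sg) (Solved sg)
| Decomp1 x s L M sg :
    L <> [] -> vty x = TList ->
    step x' (Eqn (IVar x :: L) (s :: M) sg)
            (Eqn L M (comp sg (sub1 x (Item s))))
| Decomp1' x a L M sg :
    L <> [] -> tle (ity a) (vty x) = true -> tle (vty x) TAtom = true ->
    step x' (Eqn (IVar x :: L) (a :: M) sg)
            (Eqn (nsub L x a) (nsub M x a) (comp sg (sub1 x (Item a))))
| Decomp2 x y L M sg :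
    L <> [] -> vty x = TList -> vty y = TList ->
    step x' (Eqn (IVar x :: L) (IVar y :: M) sg)
            (Eqn (IVar x' :: L) M
                 (comp sg (sub1 x (Cat (Item (IVar y)) (Item (IVar x'))))))
| Decomp2' x y L M sg :
    L <> [] -> vty x = TList -> vty y = TList ->
    step x' (Eqn (IVar x :: L) (IVar y :: M) sg)
            (Eqn L (IVar x' :: M)
                 (comp sg (sub1 y (Cat (Item (IVar x)) (Item (IVar x'))))))
| Decomp3 s L M sg :
    step x' (Eqn (s :: L) (s :: M) sg) (Eqn L M sg)
| Decomp4 x a y sg :
    atomic a -> vty x = TAtom -> vty y = TList ->
    step x' (Eqn [IVar x] [a; IVar y] sg)
            (Eqn [] [IVar y] (comp sg (sub1 x (Item a))))
(* Decomp4 for x of type int or string.  Without it < x = 1:y >, with x of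
   type int and y of type list, is neither solved nor failed and admits no
   step, although {x -> 1, y -> empty} unifies it. *)
| Decomp4' x a y sg :
    tle (ity a) (vty x) = true -> tlt (vty x) TAtom -> vty y = TList ->
    step x' (Eqn [IVar x] [a; IVar y] sg)
            (Eqn [] [IVar y] (comp sg (sub1 x (Item a))))
| Subst1 x L sg :
    ~ In (IVar x) L -> tle (type_of L) (vty x) = true ->
    step x' (Eqn [IVar x] L sg) (Solved (comp sg (sub1 x (to_expr L))))
| Subst2 x L M sg :
    L <> [] -> vty x = TList ->
    step x' (Eqn (IVar x :: L) M sg) (Eqn L M (comp sg (sub1 x Empty)))
| Subst3 x a L M sg :
    L <> [] -> atomic a -> vty x = TList ->
    step x' (Eqn (IVar x :: L) (a :: M) sg)
            (Eqn (IVar x' :: L) M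
                 (comp sg (sub1 x (Cat (Item a) (Item (IVar x'))))))
| Orient1 a x L M sg :
    ~ is_var a ->
    step x' (Eqn (a :: M) (IVar x :: L) sg) (Eqn (IVar x :: L) (a :: M) sg)
| Orient2 x y L sg :
    L <> [] -> vty x = vty y ->
    step x' (Eqn (IVar x :: L) [IVar y] sg) (Eqn [IVar y] (IVar x :: L) sg)
| Orient3 x y L M sg :
    tlt (vty y) (vty x) ->
    step x' (Eqn (IVar y :: M) (IVar x :: L) sg)
            (Eqn (IVar x :: L) (IVar y :: M) sg)
| Orient4 x L sg :
    vty x = TList ->
    step x' (Eqn [] (IVar x :: L) sg) (Eqn (IVar x :: L) [] sg)
| Occur x L sg :
    In (IVar x) L -> L <> [IVar x] -> vty x = TList ->
    step x' (Eqn [IVar x] L sg) Fail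
| Clash1 a b L M sg :
    a <> b -> ~ is_var a -> ~ is_var b ->
    step x' (Eqn (a :: L) (b :: M) sg) Fail
| Clash2 a L sg :
    atomic a -> step x' (Eqn (a :: L) [] sg) Fail
| Clash3 a L sg :
    atomic a -> step x' (Eqn [] (a :: L) sg) Fail
| Clash4 x L sg :
    tincomp (vty x) (type_of L) -> step x' (Eqn [IVar x] L sg) Fail.

(* Fresh for N in a run on input s = t.  Every variable met earlier on the
   branch leading to N occurs in s or t, or in the domain or range of the
   substitution of N. *)
Definition fresh (s t : expr) (N : problem) (z : var) : Prop :=
  vty z = TList /\ ~ occurs z s /\ ~ occurs z t /\
  match N with
  | Eqn L M sg =>
      ~ In (IVar z) L /\ ~ In (IVar z) M /\
      ~ in_dom sg z /\ (forall x, in_dom sg x -> ~ occurs z (sg x))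
  | _ => True
  end.

(* The premise is needed only because substitutions are functions: one with
   infinite support may leave no fresh variable. *)
Definition fresh_supply (s t : expr) (new : problem -> var) : Prop :=
  forall N, (exists z, fresh s t N z) -> fresh s t N (new N).

(* run new Q U R : started with queue Q and accumulated set U, the loop
   terminates and returns R. *)
Inductive run (new : problem -> var) :
  list problem -> list subst -> list subst -> Prop :=
| run_return U : run new [] U U
| run_solved sg Q U R :
    run new Q (sg :: U) R ->
    run new (Solved sg :: Q) U R
| run_fail N Q U R :
    step (new N) N Fail ->
    run new Q U R ->
    run new (N :: Q) U R
| run_expand N Ps Q U R :
    (forall sg, N <> Solved sg) ->
    ~ step (new N) N Fail ->
    (forall P, In P Ps <-> step (new N) N P /\ P <> Fail) ->
    run new (Q ++ Ps) U R ->
    run new (N :: Q) U R.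

(* sg belongs to the set returned by Unify on input s = t. *)
Definition generated (new : problem -> var) (s t : expr) (sg : subst) : Prop :=
  exists U, run new [Eqn (nf s) (nf t) id_subst] [] U /\ In sg U.

(* Main.v *)
(* Every rule but the orienting ones shortens the equation, so Unify terminates
   and returns every substitution reachable without meeting a failing problem.
   It remains to follow [delta] through the search: as long as some
   substitution [la] solves the current equation, no failure rule applies, and
   comparing the first items of both sides under [la] selects a rule whose
   result is again solved by [la], extended to the fresh variable if there is
   one. *)

From Stdlib Require Import Arith List Lia Classical.
Require Import Defs.
Import ListNotations.

(** * Normal forms *)

Definition inst (th : subst) (i : item) : nexpr := nf (app (Item i) th).
Definition insts (th : subst) (L : nexpr) : nexpr := flat_map (inst th) L.

Lemma insts_cons th i L : insts th (i :: L) = inst th i ++ insts th L.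
Proof. reflexivity. Qed.

Lemma insts_app th L M : insts th (L ++ M) = insts th L ++ insts th M.
Proof. apply flat_map_app. Qed.

Lemma nf_to_expr L : nf (to_expr L) = L.
Proof.
  induction L as [|i [|j L] IH]; auto.
  change (i :: nf (to_expr (j :: L)) = i :: j :: L). now rewrite IH.
Qed.

(** Moves substitution to lists of items, where the later reasoning takes place. *)
Lemma nf_app e th : nf (app e th) = insts th (nf e).
Proof.
  induction e as [|i|e1 IH1 e2 IH2]; auto.
  - cbn [nf insts flat_map]. now rewrite app_nil_r.
  - cbn [nf app]. now rewrite IH1, IH2, insts_app.
Qed.

Lemma au_nf e : au e (to_expr (nf e)).
Proof.
  assert (Hcat : forall L M, au (Cat (to_expr L) (to_expr M)) (to_expr (L ++ M))).
  { intros L M. induction L as [|i [|j L] IH].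
    - apply au_emptyl.
    - destruct M; [apply au_emptyr|apply au_refl].
    - eapply au_trans; [apply au_sym, (au_assoc (Item i) (to_expr (j :: L)))|].
      apply (au_cat _ _ _ _ (au_refl (Item i)) IH). }
  induction e as [|i|e1 IH1 e2 IH2]; try apply au_refl.
  eapply au_trans; [apply au_cat; eassumption|apply Hcat].
Qed.

(** Expressions modulo AU form the free monoid on items, and [nf] gives the word of each class. *)
Lemma au_iff_nf e f : au e f <-> nf e = nf f.
Proof.
  split.
  - induction 1; cbn; try congruence.
    + apply app_assoc.
    + apply app_nil_r.
  - intros H. eapply au_trans; [apply au_nf|].
    rewrite H. apply au_sym, au_nf.
Qed.

Lemma insts_comp sg th L : insts (comp sg th) L = insts th (insts sg L).
Proof.
  induction L as [|i L IH]; auto.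
  rewrite !insts_cons, insts_app, IH. f_equal.
  destruct i as [z|w|x]; auto. exact (nf_app (sg x) th).
Qed.

Lemma inst_sub1_eq x e : inst (sub1 x e) (IVar x) = nf e.
Proof. unfold inst, sub1. cbn. now destruct (var_eq_dec x x). Qed.

Lemma inst_sub1_neq x e i : i <> IVar x -> inst (sub1 x e) i = [i].
Proof.
  intros H. destruct i as [z|w|y]; auto.
  unfold inst, sub1. cbn. destruct (var_eq_dec x y); [congruence|auto].
Qed.

Lemma insts_sub1_notin x e L : ~ In (IVar x) L -> insts (sub1 x e) L = L.
Proof.
  induction L as [|i L IH]; auto; intros H.
  rewrite insts_cons, IH, inst_sub1_neq; cbn in *; intuition.
Qed.

Lemma nsub_insts L x i : nsub L x i = insts (sub1 x (Item i)) L.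
Proof. unfold nsub. now rewrite nf_app, nf_to_expr. Qed.

(** * Termination and the contents of the returned set *)

(** [Orient1], [Orient3] and [Orient4] bring the head of larger rank to the left. The factor 2 in
    [measure] lets this outweigh the summand 1 that [Orient2] removes. *)
Definition head_rank (L : nexpr) : nat :=
  match L with
  | [] => 0
  | IVar x :: _ => match vty x with TList => 4 | TAtom => 3 | _ => 2 end
  | _ => 1
  end.

(* The second summand, at most 9, is what the orienting rules lower. *)
Definition measure (P : problem) : nat :=
  match P with
  | Eqn L M _ =>
      10 * (length L + length M)
      + (2 * (head_rank M - head_rank L)
         + match L, M with _ :: _ :: _, [_] => 1 | _, _ => 0 end) + 1
  | _ => 0
  end.

Lemma head_rank_le L : head_rank L <= 4.
Proof. destruct L as [|[| |[[] ?]] L]; cbn; lia. Qed.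

Lemma nsub_length L x i : length (nsub L x i) = length L.
Proof.
  rewrite nsub_insts. induction L as [|j L IH]; auto.
  rewrite insts_cons, length_app, IH.
  destruct (classic (j = IVar x)) as [->|H].
  - now rewrite inst_sub1_eq.
  - now rewrite inst_sub1_neq.
Qed.

(** One item counts 10, more than the second summand of [measure] can reach. *)
Lemma measure_lt_length L M sg L' M' sg' :
  length L + length M < length L' + length M' ->
  measure (Eqn L M sg) < measure (Eqn L' M' sg').
Proof.
  intros H. unfold measure.
  pose proof (head_rank_le M).
  assert (match L, M with _ :: _ :: _, [_] => 1 | _, _ => 0 end <= 1)
    by (destruct L as [|? [|]]; destruct M as [|? [|]]; lia).
  lia.
Qed.

Lemma step_measure z N P : step z N P -> measure P < measure N.
Proof.
  destruct 1; try (cbn [measure]; lia);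
    try (apply measure_lt_length; rewrite ?nsub_length; cbn [length]; lia).
  (* Only the four orienting rules remain. *)
  - destruct a; [| |now destruct H; eexists];
      destruct x as [[] ?]; cbn; destruct L, M; cbn; lia.
  - destruct L; [easy|]. cbn. rewrite H0. lia.
  - destruct H as [H H'], x as [[] ?], y as [[] ?]; cbn in *; try easy;
      destruct L as [|? L], M as [|? M]; try destruct L; try destruct M;
      cbn; lia.
  - cbn. rewrite H. destruct L; cbn; lia.
Qed.

(** Ignores side conditions: the list only has to contain every nonfailing result and to be short,
    so rules of the same shape share an entry. *)
Definition candidates (z : var) (N : problem) : list problem :=
  match N with
  | Eqn L M sg =>
      [Solved sg; Eqn M L sg; Eqn (tl L) (tl M) sg] ++
      match L with
      | IVar x :: L' =>
          [Solved (comp sg (sub1 x (to_expr M)));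
           Eqn L' M (comp sg (sub1 x Empty))] ++
          match M with
          | i :: M' =>
              [Eqn L' M' (comp sg (sub1 x (Item i)));
               Eqn (nsub L' x i) (nsub M' x i) (comp sg (sub1 x (Item i)));
               Eqn (IVar z :: L') M'
                   (comp sg (sub1 x (Cat (Item i) (Item (IVar z)))))] ++
              match i with
              | IVar y =>
                  [Eqn L' (IVar z :: M')
                       (comp sg (sub1 y (Cat (Item (IVar x)) (Item (IVar z)))))]
              | _ => []
              end
          | [] => []
          end
      | _ => []
      end
  | _ => []
  end.

Lemma step_candidates z N P :
  step z N P -> P <> Fail -> In P (candidates z N).
Proof.
  destruct 1; intros HP; try easy; cbn [candidates tl]; rewrite ?in_app_iff;
    cbn [In]; intuition.
Qed.

Lemma candidates_length z N : length (candidates z N) <= 9.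
Proof. destruct N as [[|[| |] L] [|[| |] M] sg| |]; cbn; lia. Qed.

(** Excluded middle replaces a Boolean test, since [step] involves equality of substitutions, which
    are functions. *)
Lemma filter_prop {A} (Q : A -> Prop) (l : list A) :
  exists l', (forall a, In a l' <-> In a l /\ Q a) /\ length l' <= length l.
Proof.
  induction l as [|a l [l' [IH Hl]]].
  - exists []. cbn. intuition.
  - destruct (classic (Q a)) as [H|H].
    + exists (a :: l'). cbn. split; [|lia].
      intros b. rewrite IH. intuition congruence.
    + exists l'. cbn. split; [|lia].
      intros b. rewrite IH. intuition congruence.
Qed.

Lemma successors z N :
  exists Ps, (forall P, In P Ps <-> step z N P /\ P <> Fail) /\ length Ps <= 9.
Proof.
  destruct (filter_prop (fun P => step z N P /\ P <> Fail) (candidates z N))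
    as [Ps [H Hl]].
  exists Ps. split.
  - intros P. rewrite H. intuition. now apply step_candidates.
  - pose proof (candidates_length z N). lia.
Qed.

(* A problem outweighs all its successors together, there being at most 9. *)
Definition weight (Q : list problem) : nat :=
  list_sum (map (fun N => 10 ^ measure N) Q).

Lemma weight_successors z N Ps :
  (forall P, In P Ps -> step z N P) -> length Ps <= 9 ->
  weight Ps < 10 ^ measure N.
Proof.
  intros H Hl.
  destruct (measure N) as [|m] eqn:Em.
  - destruct Ps as [|P Ps]; [cbn; lia|].
    specialize (H P (or_introl eq_refl)). apply step_measure in H. lia.
  (* Each successor has measure at most [m], so together they weigh at most 9 times [10 ^ m]. *)
  - assert (Hw : weight Ps <= length Ps * 10 ^ m).
    { clear Hl. induction Ps as [|P Ps IH]; [easy|].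
      unfold weight in *. cbn [map list_sum fold_right length].
      fold (list_sum (map (fun N => 10 ^ measure N) Ps)).
      assert (measure P <= m).
      { specialize (H P (or_introl eq_refl)). apply step_measure in H. lia. }
      assert (10 ^ measure P <= 10 ^ m) by (apply Nat.pow_le_mono_r; lia).
      specialize (IH (fun P' HP => H P' (or_intror HP))). lia. }
    assert (0 < 10 ^ m) by (apply Nat.neq_0_lt_0, Nat.pow_nonzero; lia).
    cbn [Nat.pow]. nia.
Qed.

(** A single branch of the search, independent of the queue, that expands no failing problem. *)
Inductive reaches (new : problem -> var) : problem -> subst -> Prop :=
| reaches_solved sg : reaches new (Solved sg) sg
| reaches_step N P sg :
    ~ step (new N) N Fail -> step (new N) N P -> reaches new P sg ->
    reaches new N sg.

(** Induction on the weight of the queue, which every iteration lowers. The clause [incl U R]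
    carries along what has already been collected. *)
Lemma run_collects new Q U :
  exists R, run new Q U R /\ incl U R /\
    forall N sg, In N Q -> reaches new N sg -> In sg R.
Proof.
  remember (weight Q) as n eqn:En. revert Q U En.
  induction n as [n IH] using lt_wf_ind. intros [|N Q] U ->.
  { exists U. repeat split; [constructor|apply incl_refl|easy]. }
  assert (Hw : weight (N :: Q) = 10 ^ measure N + weight Q) by reflexivity.
  assert (0 < 10 ^ measure N) by (apply Nat.neq_0_lt_0, Nat.pow_nonzero; lia).
  destruct (classic (exists sg, N = Solved sg)) as [[sg ->]|HS].
  { destruct (IH (weight Q) ltac:(lia) Q (sg :: U) eq_refl) as [R [HR [HU HQ]]].
    exists R. repeat split.
    - now constructor.
    - intros u Hu. apply HU. now right.
    - intros N sg' [<-|HN] Hr; [|eauto].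
      inversion Hr as [|? P ? _ HP]; subst; [apply HU; now left|inversion HP]. }
  destruct (classic (step (new N) N Fail)) as [HF|HF].
  { destruct (IH (weight Q) ltac:(lia) Q U eq_refl) as [R [HR [HU HQ]]].
    exists R. repeat split; auto.
    - now apply run_fail.
    - intros N' sg [<-|HN] Hr; [|eauto].
      destruct Hr; [destruct HS; eauto|easy]. }
  destruct (successors (new N) N) as [Ps [HPs Hl]].
  assert (Hlt : weight Ps < 10 ^ measure N).
  { apply weight_successors with (new N); auto. intros P HP. now apply HPs. }
  assert (Happ : weight (Q ++ Ps) = weight Q + weight Ps).
  { unfold weight. now rewrite map_app, list_sum_app. }
  destruct (IH (weight (Q ++ Ps)) ltac:(lia) (Q ++ Ps) U eq_refl)
    as [R [HR [HU HQ]]].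
  exists R. repeat split; auto.
  - apply run_expand with Ps; auto. intros sg E. apply HS. eauto.
  - intros N' sg [<-|HN] Hr; [|apply (HQ N'); auto; apply in_app_iff; auto].
    destruct Hr as [|N P sg _ HP Hr]; [destruct HS; eauto|].
    apply (HQ P); auto. apply in_app_iff. right. apply HPs. split; auto.
    (* [Fail] admits no step, so it reaches nothing. *)
    intros ->. inversion Hr as [|? ? ? _ HP']. inversion HP'.
Qed.

(** * List variables *)

(** Repetitions are kept, so that length at most 1 expresses simplicity. *)
Definition list_vars (L : nexpr) : list var :=
  flat_map (fun i => match i with
                     | IVar x => match vty x with TList => [x] | _ => [] end
                     | _ => []
                     end) L.

Lemma list_vars_list x L :
  vty x = TList -> list_vars (IVar x :: L) = x :: list_vars L.
Proof. intros H. cbn. now rewrite H. Qed.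

Lemma list_vars_atomic i L : atomic i -> list_vars (i :: L) = list_vars L.
Proof.
  unfold atomic. intros H. destruct i as [z|w|x]; auto.
  cbn in *. now destruct (vty x).
Qed.

Lemma atomic_or_list i :
  atomic i \/ exists x, i = IVar x /\ vty x = TList.
Proof.
  unfold atomic. destruct i as [z|w|x]; try (now left).
  cbn. destruct (vty x) eqn:E; try (now left). right. now exists x.
Qed.

Lemma in_list_vars x L : vty x = TList -> In (IVar x) L -> In x (list_vars L).
Proof.
  intros Hx H. apply in_flat_map. exists (IVar x). rewrite Hx. cbn. auto.
Qed.

Lemma list_vars_in x L : In x (list_vars L) -> In (IVar x) L.
Proof.
  intros H. apply in_flat_map in H as [[z|w|y] [Hi H]]; try easy.
  destruct (vty y); try easy. now destruct H as [->|[]].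
Qed.

Lemma in_nf x e : In (IVar x) (nf e) -> occurs x e.
Proof.
  induction e as [|i|e1 IH1 e2 IH2]; cbn; auto.
  - intuition.
  - rewrite in_app_iff. intuition.
Qed.

Lemma list_vars_nf e : length (list_vars (nf e)) = nb_list_vars e.
Proof.
  induction e as [|[z|w|[[] n]]|e1 IH1 e2 IH2]; auto.
  cbn [nf nb_list_vars]. unfold list_vars in *.
  now rewrite flat_map_app, length_app, IH1, IH2.
Qed.

(** Lets [Decomp1'] preserve [wf]: neither the replaced variable nor its replacement is a list
    variable. *)
Lemma list_vars_nsub L x i :
  vty x <> TList -> atomic i -> list_vars (nsub L x i) = list_vars L.
Proof.
  intros Hx Hi. rewrite nsub_insts.
  induction L as [|j L IH]; auto. rewrite insts_cons.
  destruct (classic (j = IVar x)) as [->|H].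
  - rewrite inst_sub1_eq. cbn [nf List.app].
    now rewrite !list_vars_atomic.
  - rewrite inst_sub1_neq by assumption. cbn [List.app].
    destruct (atomic_or_list j) as [Hj|[y [-> Hy]]].
    + now rewrite !list_vars_atomic.
    + now rewrite !list_vars_list, IH.
Qed.

(** Disjointness is demanded of list variables only: [Decomp1'] may put the same variable of smaller
    type on both sides. *)
Definition wf (L M : nexpr) : Prop :=
  length (list_vars L) <= 1 /\ length (list_vars M) <= 1 /\
  forall x, In x (list_vars L) -> ~ In x (list_vars M).

Lemma wf_sym L M : wf L M -> wf M L.
Proof. unfold wf. firstorder. Qed.

Lemma wf_tail i L M : wf (i :: L) M -> wf L M.
Proof.
  destruct (atomic_or_list i) as [H|[x [-> H]]]; unfold wf.
  - now rewrite list_vars_atomic.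
  - rewrite list_vars_list by assumption. cbn. intuition (auto with arith); eauto.
Qed.

(** The head uses up the one list variable its side may have, so binding it leaves the rest of the
    equation unchanged. *)
Lemma wf_list x L M :
  vty x = TList -> wf (IVar x :: L) M ->
  ~ In (IVar x) L /\ ~ In (IVar x) M /\ list_vars L = [].
Proof.
  intros Hx. unfold wf. rewrite list_vars_list by assumption. cbn.
  intros [H1 [_ H3]].
  destruct (list_vars L) as [|y l] eqn:E; [|cbn in H1; lia].
  repeat split; intros H; apply in_list_vars in H; auto.
  - now rewrite E in H.
  - now apply (H3 x); auto.
Qed.

Lemma wf_fresh z L M :
  vty z = TList -> ~ In (IVar z) M -> list_vars L = [] ->
  length (list_vars M) <= 1 -> wf (IVar z :: L) M.
Proof.
  intros Hz HM HL Hl. unfold wf. rewrite list_vars_list, HL by assumption.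
  repeat split; cbn; auto.
  intros x [->|[]] H. now apply HM, list_vars_in.
Qed.

(** * Instances *)

Definition solves (L M : nexpr) (th : subst) : Prop := insts th L = insts th M.

Lemma inst_const th i : ~ is_var i -> inst th i = [i].
Proof.
  intros H. destruct i as [z|w|x]; auto. now destruct H; exists x.
Qed.

(** [empty] and proper concatenations have type [list], so a smaller type forces exactly one item.
    This makes heads comparable. *)
Lemma inst_atomic th i :
  substitution th -> atomic i ->
  exists k, inst th i = [k] /\ tle (ity k) (ity i) = true.
Proof.
  intros Hth Hi. destruct i as [z|w|x]; try (eexists; split; reflexivity).
  specialize (Hth x). unfold atomic, inst in *. cbn in *.
  destruct (nf (th x)) as [|k [|? ?]]; cbn in Hth;
    [now destruct (vty x)| |now destruct (vty x)].
  now exists k.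
Qed.

(** Atomic items have nonempty instances. The equality of lengths says that every item of [L] is a
    list variable. *)
Lemma insts_nil th L :
  substitution th -> insts th L = [] -> length L = length (list_vars L).
Proof.
  intros Hth. induction L as [|i L IH]; auto. rewrite insts_cons. intros H.
  apply app_eq_nil in H as [Hi HL].
  destruct (atomic_or_list i) as [H|[x [-> H]]].
  - destruct (inst_atomic th i Hth H) as [k [E _]]. congruence.
  - rewrite list_vars_list by assumption. cbn. auto.
Qed.

Lemma insts_ext th th' L :
  (forall i, In i L -> inst th i = inst th' i) -> insts th L = insts th' L.
Proof.
  induction L as [|i L IH]; auto. intros H. rewrite !insts_cons, H, IH; auto.
  - intros j Hj. apply H. now right.
  - now left.
Qed.

Lemma insts_comp_sub1_notin x e th L :
  ~ In (IVar x) L -> insts (comp (sub1 x e) th) L = insts th L.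
Proof. intros H. now rewrite insts_comp, insts_sub1_notin. Qed.

Lemma inst_comp sg th i : inst (comp sg th) i = insts th (inst sg i).
Proof.
  pose proof (insts_comp sg th [i]) as H. rewrite !insts_cons in H.
  cbn [insts flat_map] in H. now rewrite !app_nil_r in H.
Qed.

Lemma inst_comp_sub1 x e th :
  inst (comp (sub1 x e) th) (IVar x) = insts th (nf e).
Proof. now rewrite inst_comp, inst_sub1_eq. Qed.

Lemma inst_comp_sub1_neq x e th i :
  i <> IVar x -> inst (comp (sub1 x e) th) i = inst th i.
Proof.
  intros H. rewrite inst_comp, inst_sub1_neq, insts_cons by assumption.
  apply app_nil_r.
Qed.

(** Below type [list] the image is a single atomic item, whose instance is again a single item of no
    larger type. *)
Lemma substitution_comp sg th :
  substitution sg -> substitution th -> substitution (comp sg th).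
Proof.
  intros Hsg Hth x. specialize (Hsg x). unfold comp. rewrite nf_app.
  destruct (vty x) eqn:Ex; try (now destruct (type_of (insts th (nf (sg x)))));
  destruct (nf (sg x)) as [|i [|? ?]]; cbn in Hsg; try easy;
  (destruct (inst_atomic th i Hth) as [k [E Hk]];
    [unfold atomic; now destruct (ity i)|]);
  rewrite insts_cons, E; cbn in *;
  now destruct (ity i), (ity k).
Qed.

Lemma substitution_sub1 x e :
  tle (type_of (nf e)) (vty x) = true -> substitution (sub1 x e).
Proof.
  intros H y. unfold sub1. destruct (var_eq_dec x y) as [<-|]; auto.
  cbn. now destruct (vty y).
Qed.

Lemma tle_list a : tle a TList = true.
Proof. now destruct a. Qed.

(** * Finite support *)

Lemma occurs_bound e : exists n, forall v, occurs v e -> vname v < n.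
Proof.
  induction e as [|i|e1 [n1 IH1] e2 [n2 IH2]].
  - now exists 0.
  - destruct i as [z|w|x]; try (now exists 0).
    exists (S (vname x)). intros v [= ->]. lia.
  - exists (n1 + n2). intros v [H|H]; [apply IH1 in H|apply IH2 in H]; lia.
Qed.

Lemma occurs_app v e th :
  occurs v (app e th) -> exists u, occurs u e /\ occurs v (th u).
Proof.
  induction e as [|i|e1 IH1 e2 IH2]; cbn; try easy.
  - destruct i as [z|w|x]; try easy. eauto.
  - intros [H|H]; [apply IH1 in H|apply IH2 in H]; firstorder.
Qed.

(** One bound for names in both domain and range; it guarantees that a fresh variable exists, as
    [fresh_supply] presupposes. *)
Definition finite_support (sg : subst) : Prop :=
  exists n, forall y, sg y = Item (IVar y) \/
    vname y < n /\ forall v, occurs v (sg y) -> vname v < n.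

Lemma finite_support_comp sg x e :
  finite_support sg -> finite_support (comp sg (sub1 x e)).
Proof.
  intros [n H]. destruct (occurs_bound e) as [m Hm].
  exists (S (n + m + vname x)). intros y. unfold comp.
  destruct (H y) as [->|[Hy Hv]].
  - cbn. unfold sub1. destruct (var_eq_dec x y) as [<-|]; auto.
    right. split; [lia|]. intros v E. apply Hm in E. lia.
  - right. split; [lia|]. intros v E. apply occurs_app in E as [u [Hu E]].
    apply Hv in Hu. unfold sub1 in E. destruct (var_eq_dec x u).
    + apply Hm in E. lia.
    + cbn in E. injection E as ->. lia.
Qed.

Lemma fresh_exists s t L M sg :
  finite_support sg -> exists z, fresh s t (Eqn L M sg) z.
Proof.
  intros [n Hn].
  destruct (occurs_bound s) as [a Ha]. destruct (occurs_bound t) as [b Hb].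
  assert (Hin : forall K, exists n, forall v, In (IVar v) K -> vname v < n).
  { intros K. destruct (occurs_bound (to_expr K)) as [k Hk]. exists k.
    intros v Hv. apply Hk, in_nf. now rewrite nf_to_expr. }
  destruct (Hin L) as [c Hc]. destruct (Hin M) as [d Hd].
  (* This name is at least as large as each of the five strict bounds. *)
  exists (Var TList (n + a + b + c + d)). cbn. repeat split; intros.
  - intros H. apply Ha in H. cbn in H. lia.
  - intros H. apply Hb in H. cbn in H. lia.
  - intros H. apply Hc in H. cbn in H. lia.
  - intros H. apply Hd in H. cbn in H. lia.
  - intros H. destruct (Hn (Var TList (n + a + b + c + d))) as [E|[E _]]; auto.
    cbn in E. lia.
  - intros H'. destruct (Hn x) as [E|[_ E]]; auto. apply E in H'. cbn in H'. lia.
Qed.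

(** * The invariant *)

(* [C] is the set of solutions of the equation still to be solved.  The
   solution [la] makes [delta] factor through [sg], and is extended to the
   fresh variables as they are introduced. *)
Record inv (s t : expr) (delta : subst) (C : subst -> Prop) (sg la : subst)
  : Prop := {
  inv_subst : substitution sg;
  inv_finite : finite_support sg;
  inv_la : substitution la;
  inv_solves : C la;
  inv_factor : forall x, occurs x s \/ occurs x t ->
    nf (delta x) = nf (app (sg x) la);
  inv_sound : forall th, substitution th -> C th ->
    nf (app s (comp sg th)) = nf (app t (comp sg th)) }.

Arguments inv_la {s t delta C sg la}.
Arguments inv_solves {s t delta C sg la}.
Arguments inv_sound {s t delta C sg la}.

(** For the rules that leave the substitution unchanged. *)
Lemma inv_weaken s t delta (C C' : subst -> Prop) sg la :
  inv s t delta C sg la -> C' la -> (forall th, C' th -> C th) ->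
  inv s t delta C' sg la.
Proof. intros []; constructor; auto. Qed.

Lemma insts_ext_nf th th' L :
  (forall x, nf (th x) = nf (th' x)) -> insts th L = insts th' L.
Proof. intros H. apply insts_ext. intros [z|w|x] _; auto. apply H. Qed.

(** Binding [x] to [e] keeps the factorisation of [delta] because the binding followed by [la']
    agrees with [la] on every variable in the relevant images under [sg]. Soundness survives because
    each solution [th] of the new equation yields a solution of the old one by composition. *)
Lemma inv_bind_update s t delta (C C' : subst -> Prop) sg la la' x e :
  inv s t delta C sg la ->
  tle (type_of (nf e)) (vty x) = true ->
  substitution la' ->
  (forall y v, occurs y s \/ occurs y t -> occurs v (sg y) ->
     inst la (IVar v) = inst (comp (sub1 x e) la') (IVar v)) ->
  C' la' ->
  (forall th, C' th -> C (comp (sub1 x e) th)) ->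
  inv s t delta C' (comp sg (sub1 x e)) la'.
Proof.
  intros [H1 H2 H3 H4 H5 H6] He Hla' Hla HC' HC.
  apply substitution_sub1 in He. constructor; auto.
  - now apply substitution_comp.
  - now apply finite_support_comp.
  - intros y Hy. rewrite H5 by assumption. unfold comp.
    rewrite !nf_app, <- insts_comp. apply insts_ext.
    intros [z|w|v] Hv; auto. apply Hla with y; auto. now apply in_nf.
  - intros th Hth HCth.
    specialize (H6 (comp (sub1 x e) th)
      ltac:(now apply substitution_comp) (HC th HCth)).
    rewrite !nf_app in *.
    (* Composition is associative up to normal forms. *)
    rewrite !(insts_ext_nf (comp (comp sg (sub1 x e)) th)
                            (comp sg (comp (sub1 x e) th))); auto;
    intros y; unfold comp at 1 2 3; rewrite !nf_app; symmetry; apply insts_comp.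
Qed.

(** Since [la] already identifies [x] with [e], it absorbs the binding and needs no extension. *)
Lemma inv_bind s t delta (C C' : subst -> Prop) sg la x e :
  inv s t delta C sg la ->
  tle (type_of (nf e)) (vty x) = true ->
  inst la (IVar x) = insts la (nf e) ->
  C' la ->
  (forall th, C' th -> C (comp (sub1 x e) th)) ->
  inv s t delta C' (comp sg (sub1 x e)) la.
Proof.
  intros H He Hx HC' HC. apply inv_bind_update with C la; auto.
  { apply H. }
  intros y v _ _. destruct (classic (v = x)) as [->|Hv].
  - now rewrite inst_comp_sub1.
  - now rewrite inst_comp_sub1_neq by congruence.
Qed.

Definition update (la : subst) (z : var) (w : nexpr) : subst :=
  fun v => if var_eq_dec z v then to_expr w else la v.

Lemma inst_update_eq la z w : inst (update la z w) (IVar z) = w.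
Proof.
  unfold inst, update. cbn. destruct (var_eq_dec z z); [|easy].
  apply nf_to_expr.
Qed.

Lemma inst_update_neq la z w i :
  i <> IVar z -> inst (update la z w) i = inst la i.
Proof.
  intros H. destruct i as [n|c|v]; auto. unfold inst, update. cbn.
  destruct (var_eq_dec z v); congruence.
Qed.

Lemma insts_update_notin la z w L :
  ~ In (IVar z) L -> insts (update la z w) L = insts la L.
Proof.
  intros H. apply insts_ext. intros i Hi. apply inst_update_neq. congruence.
Qed.

(** The value of [x] under [la] splits into the instance of [i] and a remainder [w], which becomes
    the value of the fresh [z]. *)
Lemma inv_bind_fresh s t delta (C' : subst -> Prop) L M sg la x i z w :
  inv s t delta (solves L M) sg la ->
  fresh s t (Eqn L M sg) z ->
  vty x = TList -> i <> IVar z -> x <> z ->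
  inst la (IVar x) = inst la i ++ w ->
  C' (update la z w) ->
  (forall th, C' th ->
     solves L M (comp (sub1 x (Cat (Item i) (Item (IVar z)))) th)) ->
  inv s t delta C' (comp sg (sub1 x (Cat (Item i) (Item (IVar z)))))
      (update la z w).
Proof.
  intros H [Hz [Hs [Ht [_ [_ [Hd Hr]]]]]] Hx Hi Hxz E HC' HC.
  apply inv_bind_update with (solves L M) la; auto.
  - rewrite Hx. apply tle_list.
  - intros v. unfold update. destruct (var_eq_dec z v) as [<-|]; [|apply H].
    rewrite Hz. apply tle_list.
  - intros y v Hy Hv.
    (* If [sg] moves [y], freshness keeps [z] out of its image; otherwise [z] would be [y], a
       variable of [s] or [t]. *)
    assert (Hvz : v <> z).
    { intros ->. destruct (classic (in_dom sg y)) as [Hd'|Hd'].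
      - now apply (Hr y).
      - apply NNPP in Hd'. rewrite Hd' in Hv. injection Hv as ->. intuition. }
    destruct (classic (v = x)) as [->|Hvx].
    + rewrite inst_comp_sub1. cbn [nf List.app]. rewrite !insts_cons.
      rewrite inst_update_eq, inst_update_neq by assumption.
      cbn [insts flat_map]. now rewrite app_nil_r.
    + rewrite inst_comp_sub1_neq, inst_update_neq by congruence. reflexivity.
Qed.

(** * Progress *)

(** [Occur] contradicts [wf]; [Clash1] would equate distinct constants; [Clash2] and [Clash3] would
    give an atomic item an empty instance. *)
Lemma solvable_not_fail z L M sg la :
  wf L M -> substitution la -> solves L M la -> ~ step z (Eqn L M sg) Fail.
Proof.
  unfold solves. intros Hwf Hla E Hstep. inversion Hstep; subst.
  - apply wf_list in Hwf; tauto.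
  - rewrite !insts_cons in E.
    rewrite !inst_const in E by assumption. cbn in E. congruence.
  - destruct (inst_atomic la a Hla) as [k [Ek _]]; auto.
    rewrite insts_cons, Ek in E. easy.
  - destruct (inst_atomic la a Hla) as [k [Ek _]]; auto.
    rewrite insts_cons, Ek in E. easy.
  (* [Clash4]: both sides are single atomic items, and the type of their common instance would lie
     below two incomparable types. *)
  - destruct H0 as [H H'].
    destruct M as [|i [|j M]]; cbn [type_of] in *;
      try (now rewrite tle_list in H).
    assert (Hi : atomic i).
    { intros Hi. rewrite Hi in H. now rewrite tle_list in H. }
    assert (Hx : atomic (IVar x)).
    { intros Hx. cbn in Hx. rewrite Hx in H'. now rewrite tle_list in H'. }
    destruct (inst_atomic la _ Hla Hi) as [k [Ek Hk]].
    destruct (inst_atomic la _ Hla Hx) as [k' [Ek' Hk']].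
    rewrite !insts_cons, Ek, Ek' in E. cbn in E, Hk'. injection E as ->.
    now destruct (ity k), (ity i), (vty x).
Qed.

Definition problem_inv (s t : expr) (delta : subst) (N : problem) : Prop :=
  match N with
  | Eqn L M sg => wf L M /\ exists la, inv s t delta (solves L M) sg la
  | Solved sg => exists la, inv s t delta (fun _ => True) sg la
  | Fail => False
  end.

(** The rule is chosen by the value of [x] under [la]: [Subst1] if [x] stands alone, [Subst2] if the
    value is empty, and otherwise a rule that splits off the shorter of the two head instances. *)
Lemma progress_list_var s t delta z x L M sg :
  problem_inv s t delta (Eqn (IVar x :: L) M sg) ->
  fresh s t (Eqn (IVar x :: L) M sg) z -> vty x = TList ->
  exists P, step z (Eqn (IVar x :: L) M sg) P /\ problem_inv s t delta P.
Proof.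
  intros [Hwf [la H]] Hf Hx.
  pose proof (inv_solves H) as E.
  pose proof (inv_la H) as Hla.
  destruct (wf_list x L M Hx Hwf) as [HxL [HxM HL]].
  destruct (classic (L = [])) as [->|HLn].
  { assert (Hty : tle (type_of M) (vty x) = true) by (rewrite Hx; apply tle_list).
    eexists. split; [now apply Subst1|]. exists la.
    unfold solves in E. rewrite insts_cons in E. cbn [insts flat_map] in E.
    rewrite app_nil_r in E.
    eapply inv_bind; try exact H; rewrite ?nf_to_expr; auto.
    intros th _. unfold solves. rewrite insts_cons, inst_comp_sub1, nf_to_expr.
    rewrite (insts_comp_sub1_notin _ _ _ M) by assumption. apply app_nil_r. }
  destruct (classic (inst la (IVar x) = [])) as [Hnil|Hnil].
  { eexists. split; [now apply Subst2|].
    split; [now apply wf_tail in Hwf|]. exists la.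
    eapply inv_bind; try exact H; auto.
    - rewrite Hx. apply tle_list.
    - unfold solves in *. now rewrite insts_cons, Hnil in E.
    - intros th HC. unfold solves. rewrite insts_cons, inst_comp_sub1.
      now rewrite !insts_comp_sub1_notin. }
  pose proof Hf as [Hz [_ [_ [HzL [HzM _]]]]].
  assert (Hxz : x <> z) by (intros ->; apply HzL; now left).
  destruct M as [|j M].
  { unfold solves in E. rewrite insts_cons in E.
    now apply app_eq_nil in E as [? _]. }
  assert (HxM' : ~ In (IVar x) M) by (intros ?; apply HxM; now right).
  assert (HzL' : ~ In (IVar z) L) by (intros ?; apply HzL; now right).
  assert (HzM' : ~ In (IVar z) M) by (intros ?; apply HzM; now right).
  assert (Hjx : j <> IVar x) by (intros ->; apply HxM; now left).
  assert (Hjz : j <> IVar z) by (intros ->; apply HzM; now left).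
  pose proof E as E0. unfold solves in E0. rewrite !insts_cons in E0.
  (* Both head instances are prefixes of one word, so one extends the other by [w]. An atomic [j]
     contributes one item, hence falls under the first alternative. *)
  assert (Hw : exists w,
    (inst la (IVar x) = inst la j ++ w /\ insts la M = w ++ insts la L) \/
    (inst la j = inst la (IVar x) ++ w /\ insts la L = w ++ insts la M /\
     exists y, j = IVar y /\ vty y = TList)).
  { destruct (atomic_or_list j) as [Hj|Hj].
    - destruct (inst_atomic la j Hla Hj) as [k [Ek _]]. rewrite Ek in *.
      destruct (inst la (IVar x)) as [|k' l]; [easy|].
      cbn in E0. injection E0 as -> E0. exists l. now left.
    - apply app_eq_app in E0 as [w [E0|E0]]; exists w; [now left|right].
      now repeat split. }
  destruct Hw as [w [[Ex EM]|[Ej [EL [y [-> Hy]]]]]].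
  - exists (Eqn (IVar z :: L) M
             (comp sg (sub1 x (Cat (Item j) (Item (IVar z)))))).
    split.
    { destruct (atomic_or_list j) as [Hj|[y [-> Hy]]].
      - now apply Subst3.
      - now apply Decomp2. }
    split.
    { apply wf_fresh; auto. apply wf_sym, wf_tail in Hwf. apply Hwf. }
    exists (update la z w).
    eapply inv_bind_fresh; try exact H; eauto.
    + unfold solves. rewrite insts_cons, inst_update_eq.
      now rewrite !insts_update_notin.
    + intros th HC. unfold solves in *. rewrite !insts_cons in *.
      rewrite inst_comp_sub1, inst_comp_sub1_neq by assumption.
      rewrite !insts_comp_sub1_notin by assumption.
      cbn [nf List.app]. rewrite !insts_cons. cbn [insts flat_map].
      fold (insts th L). now rewrite app_nil_r, <- app_assoc, HC.
  - assert (Hyz : y <> z) by congruence.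
    destruct (wf_list y M (IVar x :: L) Hy (wf_sym _ _ Hwf)) as [HyM [HyL HM]].
    assert (HyL' : ~ In (IVar y) L) by (intros ?; apply HyL; now right).
    eexists. split; [now apply Decomp2'|].
    split.
    { apply wf_sym, wf_fresh; auto. rewrite HL. auto. }
    exists (update la z w).
    eapply inv_bind_fresh; try exact H; eauto; try congruence.
    + unfold solves. rewrite insts_cons, inst_update_eq.
      now rewrite !insts_update_notin.
    + intros th HC. unfold solves in *. rewrite !insts_cons in *.
      rewrite inst_comp_sub1, inst_comp_sub1_neq by congruence.
      rewrite !insts_comp_sub1_notin by assumption.
      cbn [nf List.app]. rewrite !insts_cons. cbn [insts flat_map].
      fold (insts th M). now rewrite app_nil_r, <- app_assoc, HC.
Qed.

(** Both heads have the same one-item instance, so they can be cancelled, or bound to each other,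
    possibly after a swap. *)
Lemma progress_atomic s t delta z i j L M sg :
  problem_inv s t delta (Eqn (i :: L) (j :: M) sg) ->
  atomic i -> atomic j ->
  exists P, step z (Eqn (i :: L) (j :: M) sg) P /\ problem_inv s t delta P.
Proof.
  intros [Hwf [la H]] Hi Hj.
  pose proof (inv_solves H) as E.
  pose proof (inv_la H) as Hla.
  destruct (inst_atomic la i Hla Hi) as [k [Ek Hk]].
  destruct (inst_atomic la j Hla Hj) as [k' [Ek' Hk']].
  assert (E0 := E). unfold solves in E0. rewrite !insts_cons, Ek, Ek' in E0.
  cbn [List.app] in E0. injection E0 as <- E0.
  assert (Hwf' : wf L M) by (eapply wf_sym, wf_tail, wf_sym, wf_tail, Hwf).
  assert (Hswap : problem_inv s t delta (Eqn (j :: M) (i :: L) sg)).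
  { split; [now apply wf_sym|]. exists la.
    apply inv_weaken with (solves (i :: L) (j :: M)); auto;
      unfold solves; congruence. }
  destruct (classic (i = j)) as [->|Hij].
  { eexists. split; [apply Decomp3|]. split; auto. exists la.
    eapply inv_weaken; try exact H; auto.
    intros th HC. unfold solves in *. now rewrite !insts_cons, HC. }
  destruct (classic (is_var i)) as [[x ->]|Hiv].
  2:{ destruct (classic (is_var j)) as [[y ->]|Hjv].
      - eexists. split; [now apply Orient1|]. assumption.
      - rewrite inst_const in * by assumption. congruence. }
  assert (Hxj : inst la (IVar x) = insts la (nf (Item j))).
  { cbn [nf]. rewrite insts_cons, Ek, Ek'. reflexivity. }
  unfold atomic in Hi, Hj. cbn [ity] in Hi, Hk.
  destruct (tle (ity j) (vty x)) eqn:Hle.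
  (* The types of [x] and [j] both lie above that of [k], which rules out incomparability; a swap
     makes the larger type come first. *)
  2:{ assert (Hlt : tlt (vty x) (ity j)).
      { split; [|intros He; rewrite He in Hle; now destruct (ity j)].
        now destruct (ity k), (vty x), (ity j). }
      destruct (classic (is_var j)) as [[y ->]|Hjv].
      - eexists. split; [now apply Orient3|]. assumption.
      - exfalso. destruct Hlt as [Hlt Hne].
        destruct j as [n|w|v]; [| |now destruct Hjv; eexists];
          cbn in *; destruct (vty x); easy. }
  destruct (classic (L = [])) as [->|HL].
  - destruct M as [|y' M].
    + eexists. split.
      { apply Subst1; cbn; intuition. }
      exists la. eapply inv_bind; try exact H; auto.
      intros th _. unfold solves. rewrite !insts_cons.
      rewrite inst_comp_sub1, inst_comp_sub1_neq by auto.
      cbn [to_expr nf]. now rewrite insts_cons, app_nil_r.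
    (* The rest of the right side has an empty instance, so it consists of list variables, and [wf]
       allows only one. *)
    + assert (HM : exists y, y' :: M = [IVar y] /\ vty y = TList).
      { symmetry in E0. apply insts_nil in E0; auto.
        destruct Hwf' as [_ [Hl _]].
        destruct M; [|cbn [length] in E0; lia].
        destruct (atomic_or_list y') as [Ha|[y [-> Hy]]]; [|now exists y].
        now rewrite list_vars_atomic in E0. }
      destruct HM as [y [HM Hy]]. rewrite HM in *.
      exists (Eqn [] [IVar y] (comp sg (sub1 x (Item j)))). split.
      { destruct (vty x) eqn:Hx; [|
        |now apply Decomp4|easy];
        apply Decomp4'; rewrite ?Hx; auto; split; easy. }
      split; auto. exists la.
      eapply inv_bind; try exact H; auto.
      intros th HC. unfold solves in *. rewrite !insts_cons in *.
      rewrite inst_comp_sub1, !inst_comp_sub1_neq by congruence.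
      cbn [nf]. rewrite insts_cons. cbn [insts flat_map] in *.
      now rewrite <- HC, !app_nil_r.
  - eexists. split.
    { apply Decomp1'; auto. now destruct (vty x). }
    split.
    { unfold wf. now rewrite !list_vars_nsub. }
    exists la.
    assert (Hns : forall K th, insts th (nsub K x j)
                          = insts (comp (sub1 x (Item j)) th) K).
    { intros K th. now rewrite nsub_insts, insts_comp. }
    (* [la] gives [x] and [j] the same value, so replacing [x] by [j] first changes nothing. *)
    assert (Hself : forall K, insts (comp (sub1 x (Item j)) la) K = insts la K).
    { intros K. apply insts_ext. intros c _.
      destruct (classic (c = IVar x)) as [->|Hc].
      - now rewrite inst_comp_sub1.
      - now apply inst_comp_sub1_neq. }
    eapply inv_bind; try exact H; auto; unfold solves.
    + now rewrite !Hns, !Hself.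
    + intros th HC. rewrite !Hns in HC. rewrite !insts_cons, HC.
      rewrite inst_comp_sub1, inst_comp_sub1_neq by auto.
      cbn [nf]. now rewrite insts_cons, app_nil_r.
Qed.

Lemma progress s t delta z L M sg :
  problem_inv s t delta (Eqn L M sg) -> fresh s t (Eqn L M sg) z ->
  exists P, step z (Eqn L M sg) P /\ problem_inv s t delta P.
Proof.
  intros HN Hf. pose proof HN as [Hwf [la H]].
  pose proof (inv_solves H) as E.
  pose proof (inv_la H) as Hla. unfold solves in E.
  (* The invariant is symmetric in the two sides, which settles every orienting rule. *)
  assert (Hswap : problem_inv s t delta (Eqn M L sg)).
  { split; [now apply wf_sym|]. exists la.
    eapply inv_weaken; try exact H; auto; unfold solves; congruence. }
  destruct L as [|i L], M as [|j M].
  - eexists. split; [apply Remove|]. exists la.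
    now eapply inv_weaken; try exact H.
  - destruct (atomic_or_list j) as [Hj|[y [-> Hy]]].
    + destruct (inst_atomic la j Hla Hj) as [k [Ek _]].
      now rewrite insts_cons, Ek in E.
    + eexists. split; [now apply Orient4|]. assumption.
  - destruct (atomic_or_list i) as [Hi|[x [-> Hx]]].
    + destruct (inst_atomic la i Hla Hi) as [k [Ek _]].
      now rewrite insts_cons, Ek in E.
    + now apply progress_list_var.
  - destruct (atomic_or_list i) as [Hi|[x [-> Hx]]];
      [|now apply progress_list_var].
    destruct (atomic_or_list j) as [Hj|[y [-> Hy]]];
      [now apply progress_atomic|].
    exists (Eqn (IVar y :: M) (i :: L) sg). split; auto.
    destruct (classic (is_var i)) as [[x ->]|Hiv]; [|now apply Orient1].
    apply Orient3. split; [rewrite Hy; apply tle_list|].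
    rewrite Hy. exact Hi.
Qed.

(** * Completeness of the search *)

Lemma reaches_solution s t delta new N :
  fresh_supply s t new -> problem_inv s t delta N ->
  exists sg, reaches new N sg /\ problem_inv s t delta (Solved sg).
Proof.
  intros Hnew. remember (measure N) as n eqn:En. revert N En.
  induction n as [n IH] using lt_wf_ind. intros [L M sg|sg|] -> HN.
  - pose proof HN as [Hwf [la H]].
    assert (Hf : fresh s t (Eqn L M sg) (new (Eqn L M sg))).
    { eapply Hnew, fresh_exists, H. }
    destruct (progress s t delta _ L M sg HN Hf) as [P [HP HPi]].
    destruct (IH (measure P) (step_measure _ _ _ HP) P eq_refl HPi)
      as [sg' [Hr Hi]].
    exists sg'. split; auto. eapply reaches_step; eauto.
    exact (solvable_not_fail _ L M sg la Hwf (inv_la H) (inv_solves H)).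
  - exists sg. split; [constructor|assumption].
  - easy.
Qed.

Lemma insts_id L : insts id_subst L = L.
Proof.
  induction L as [|i L IH]; auto. rewrite insts_cons, IH. now destruct i.
Qed.

Lemma initial_inv s t delta :
  simple s -> simple t -> disjoint_vars s t -> unifier s t delta ->
  problem_inv s t delta (Eqn (nf s) (nf t) id_subst).
Proof.
  unfold simple. rewrite <- !list_vars_nf. intros Hs Ht Hst [Hd Hu].
  split.
  { repeat split; auto. intros x Hx Hx'.
    apply (Hst x); apply in_nf; now apply list_vars_in. }
  apply au_iff_nf in Hu. rewrite !nf_app in Hu.
  exists delta. constructor; auto.
  - intros x. cbn. now destruct (vty x).
  - exists 0. now left.
  - intros th _ HC. unfold solves in HC. rewrite !nf_app.
    rewrite !insts_comp, !insts_id. exact HC.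
Qed.

Theorem theorem3 (s t : expr) (hs : simple s) (ht : simple t)
  (hst : disjoint_vars s t) (delta : subst) (hdelta : unifier s t delta)
  (new : problem -> var) (hnew : fresh_supply s t new) :
  exists sigma : subst,
    generated new s t sigma /\ unifier s t sigma /\
    more_general s t sigma delta.
Proof.
  destruct (reaches_solution s t delta new _ hnew
              (initial_inv s t delta hs ht hst hdelta)) as [sg [Hr [la H]]].
  destruct (run_collects new [Eqn (nf s) (nf t) id_subst] [])
    as [R [HR [_ Hin]]].
  exists sg. repeat split.
  - exists R. split; auto. eapply Hin; [now left|exact Hr].
  - apply H.
  - apply au_iff_nf.
    assert (Hid : substitution id_subst) by (intros x; cbn; now destruct (vty x)).
    (* No equation is left, so soundness holds for every substitution; the identity shows that [sg]
       itself unifies. *)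
    pose proof (inv_sound H id_subst Hid I) as E.
    now rewrite !nf_app, !insts_comp, !insts_id, <- !nf_app in E.
  - exists la. split; [apply H|].
    intros x Hx. apply au_iff_nf. now apply H.
Qed.
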